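(* Let $W$ be a discrete memoryless channel with finite input alphabet $\mathcal{X}$ and finite output alphabet $\mathcal{Y}$, and let $q:\mathcal{X}\times\mathcal{Y}\to\mathbb{R}$ define an additive metric $q_n(x^n,y^n)=\frac1n\sum_{i=1}^n q(x_i,y_i)$. The mismatch capacity $C_q(W)$ satisfies $$C_q(W)\le\liminf_{n\to\infty}\ \max_{P_{X^n}}\ \min_{\substack{P_{\widetilde Y^n|X^n}:\\ P_{\widetilde Y^n,\,q_n(X^n,\widetilde Y^n)}=P_{Y^n,\,q_n(X^n,Y^n)}}}\ \frac1n I(X^n;\widetilde Y^n),$$ where the max is over probability distributions $P_{X^n}$ on $\mathcal{X}^n$, the min is over conditional p.m.f.s $P_{\widetilde Y^n|X^n}$ from $\mathcal{X}^n$ to $\mathcal{Y}^n$, $(X^n,\widetilde Y^n)\sim P_{X^n}\times P_{\widetilde Y^n|X^n}$, $(X^n,Y^n)\sim P_{X^n}\times W^n$, and $P_{\widetilde Y^n,q_n(X^n,\widetilde Y^n)}$ (respectively $P_{Y^n,q_n(X^n,Y^n)}$) denotes the joint distribution of the output $\widetilde Y^n$ and the random metric value $q_n(X^n,\widetilde Y^n)$ (respectively of $Y^n$ and $q_n(X^n,Y^n)$).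
   Context: $W(y|x)$ is a conditional p.m.f.; $W^n(y^n|x^n)=\prod_{i=1}^n W(y_i|x_i)$. Logarithms are natural. A codebook $\mathcal{C}_n$ with $M$ codewords is a list $x^n(1),\dots,x^n(M)\in\mathcal{X}^n$; messages are equiprobable and message $m$ is sent as $x^n(m)$ over $W^n$. The mismatched decoder $q_n$, on output $y^n$, decides on message $i$ iff $q_n(x^n(i),y^n)>q_n(x^n(j),y^n)$ for all $j\neq i$; if no such $i$ exists an error is declared. $P_e(W^n,\mathcal{C}_n,q_n)$ is the resulting average probability of error. A rate $R$ is $\epsilon$-achievable if for every $\gamma>0$ there is a sequence of codebooks $\{\mathcal{C}_n\}$ such that for all sufficiently large $n$, $\frac1n\log|\mathcal{C}_n|\ge R-\gamma$ and $P_e(W^n,\mathcal{C}_n,q_n)\le\epsilon$. The mismatch capacity $C_q(W)$ is the supremum of rates that are $\epsilon$-achievable for all $0<\epsilon<1$. *)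

(* Defs.v *)
From HB Require Import structures.
From mathcomp Require Import all_boot all_order all_algebra.
From mathcomp Require Import all_classical all_reals all_analysis.

Set Implicit Arguments.
Unset Strict Implicit.
Unset Printing Implicit Defensive.

Import Order.TTheory GRing.Theory Num.Theory.
Import numFieldNormedType.Exports.

Local Open Scope classical_set_scope.
Local Open Scope ring_scope.

(** Alphabets are finite types, and a channel is a
    curried function: [W x y] is the conditional probability W(y|x). *)

Section OneShot.
Context {R : realType} {A B : finType}.

Definition is_pmf (P : A -> R) : Prop :=
  (forall a, 0 <= P a) /\ \sum_a P a = 1.

(** Mutual information, in nats, of a pair with joint p.m.f. [P a * V a b].
    A term with [P a * V a b = 0] vanishes; in every other term both marginals
    are nonzero (for [P] a p.m.f. and [V] a channel), so the logarithm is
    applied to a positive number. *)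
Definition mutual_info (P : A -> R) (V : A -> B -> R) : R :=
  \sum_a \sum_b P a * V a b *
    ln (P a * V a b / (P a * \sum_a' P a' * V a' b)).

(** [output_metric_law m P V b t] is Pr[Y = b, m(X, Y) = t] for (X, Y)
    distributed as [P x * V x y]; as a function of [(b, t)] it is the joint
    p.m.f. of the discrete pair (Y, m(X, Y)). *)
Definition output_metric_law (m : A -> B -> R) (P : A -> R) (V : A -> B -> R)
    (b : B) (t : R) : R :=
  \sum_(a | m a b == t) P a * V a b.

End OneShot.

Definition channel {R : realType} {A B : finType} (V : A -> B -> R) : Prop :=
  forall a, is_pmf (V a).

(** A list of codewords, possibly with repetitions.  At least one message is
    required (otherwise [ln 0 = 0] and an empty sum would make the empty
    codebook error-free). *)
Record codebook (A : finType) := Codebook {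
  cb_size : nat;
  cb_size_gt0 : (0 < cb_size)%N;
  codeword :> 'I_cb_size -> A
}.

Section Decoding.
Context {R : realType} {A B : finType}.

(** [None] is the declared error; at most one message can satisfy the strict
    inequalities, so the choice made by [pick] is immaterial. *)
Definition decoder (m : A -> B -> R) (C : codebook A) (y : B) :
    option 'I_(cb_size C) :=
  [pick i | [forall j, (j != i) ==> (m (C j) y < m (C i) y)]].

Definition error_prob (V : A -> B -> R) (C : codebook A) (m : A -> B -> R) : R :=
  (cb_size C)%:R^-1 *
  \sum_(i < cb_size C) \sum_(y | decoder m C y != Some i) V (C i) y.

End Decoding.

Definition word (A : finType) (n : nat) : finType := {ffun 'I_n -> A}.

Section Memoryless.
Context {R : realType} {X Y : finType}.

Definition memoryless (W : X -> Y -> R) (n : nat) (x : word X n) (y : word Y n)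
    : R :=
  \prod_(i < n) W (x i) (y i).
Arguments memoryless : clear implicits.

Definition additive_metric (q : X -> Y -> R) (n : nat) (x : word X n)
    (y : word Y n) : R :=
  n%:R^-1 * \sum_(i < n) q (x i) (y i).
Arguments additive_metric : clear implicits.

Definition achievable (W q : X -> Y -> R) (eps rate : R) : Prop :=
  forall gamma : R, 0 < gamma ->
  exists C : forall n, codebook (word X n),
    \forall n \near \oo,
      rate - gamma <= n%:R^-1 * ln (cb_size (C n))%:R /\
      error_prob (memoryless W n) (C n) (additive_metric q n) <= eps.

Definition mismatch_capacity (W q : X -> Y -> R) : \bar R :=
  ereal_sup [set rate%:E | rate in
    [set rate : R | forall eps : R, 0 < eps < 1 -> achievable W q eps rate]].

End Memoryless.
Arguments memoryless {R X Y} W n x y.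
Arguments additive_metric {R X Y} q n x y.

(* Main.v *)
(** Take for P the law of a uniformly chosen codeword. Given the output, at most
    one codeword attains the metric value of the decoded one, so the error
    probability is a function of the joint law of the output and the metric
    value: every V in the inner minimum has the same error probability as the
    true channel. Fano's inequality for V then gives
    I(P, V) >= (1 - Pe) ln M - ln 2, and dividing by n yields the bound. *)

Require Import Defs.
From HB Require Import structures.
From mathcomp Require Import all_boot all_order all_algebra.
From mathcomp Require Import all_classical all_reals all_analysis.
From mathcomp Require Import ring lra.

Set Implicit Arguments.
Unset Strict Implicit.
Unset Printing Implicit Defensive.

Import Order.TTheory GRing.Theory Num.Theory.
Import numFieldNormedType.Exports.

Local Open Scope classical_set_scope.
Local Open Scope ring_scope.

Lemma ln_le_subr1 (R : realType) (t : R) : 0 < t -> ln t <= t - 1.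
Proof.
move=> t0; have -> : t = 1 + (t - 1) by ring.
by rewrite (le_trans (le_ln1Dx _)) //; lra.
Qed.

(** The tangent bound [ln t <= t - 1] at [t = r * f / p], multiplied by [p]. At [p = 0] the right
    side vanishes and the left side is [- r * f]. *)
Lemma mulr_ln_div_ge (R : realType) (p r f : R) :
  0 <= p -> 0 <= r -> (0 < p -> 0 < r) -> 0 < f ->
  p * ln f + p - r * f <= p * ln (p / r).
Proof.
move=> p0 r0 pr f0; have [->|pn0] := eqVneq p 0.
  by rewrite !mul0r !add0r oppr_le0 mulr_ge0 // ltW.
have pp : 0 < p by rewrite lt_neqAle eq_sym pn0.
have rp := pr pp.
have := ln_le_subr1 (divr_gt0 (mulr_gt0 rp f0) pp).
rewrite -(ler_pM2l pp) [leRHS](_ : _ = r * f - p); last by field.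
by rewrite !ln_div ?lnM ?posrE ?mulr_gt0 // => h; lra.
Qed.

Section OneShotConverse.
Context {R : realType} {A B : finType}.
Implicit Types (P : A -> R) (V : A -> B -> R) (m : A -> B -> R).
Implicit Types C : codebook A.

(** A Donsker-Varadhan type bound: sum the pointwise inequality with [p] the joint law and [r] the
    product of its marginals. The correction terms add up to 1 minus the mean of [f] under the
    product law, which is nonnegative. *)
Lemma mutual_info_ge P V (f : A -> B -> R) :
  is_pmf P -> channel V -> (forall a b, 0 < f a b) ->
  \sum_a \sum_b P a * (\sum_a' P a' * V a' b) * f a b <= 1 ->
  \sum_a \sum_b P a * V a b * ln (f a b) <= mutual_info P V.
Proof.
move=> [P0 P1] chV f0 fle1.
have sumPV : \sum_a \sum_b P a * V a b = 1.
  rewrite -P1; apply: eq_bigr => a _.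
  by rewrite -mulr_sumr (proj2 (chV a)) mulr1.
have PV0 a b : 0 <= P a * V a b by rewrite mulr_ge0 // (proj1 (chV a)).
apply: (@le_trans _ _ (\sum_a \sum_b (P a * V a b * ln (f a b) + P a * V a b
    - P a * (\sum_a' P a' * V a' b) * f a b))).
  under [leRHS]eq_bigr => a _ do rewrite sumrB big_split /=.
  by rewrite sumrB big_split /= sumPV; lra.
apply: ler_sum => a _; apply: ler_sum => b _.
apply: mulr_ln_div_ge => //.
- by rewrite mulr_ge0 // sumr_ge0.
move=> PVp; rewrite mulr_gt0 //.
  rewrite lt_neqAle P0 eq_sym andbT.
  by apply: contraTneq PVp => ->; rewrite mul0r ltxx.
rewrite (lt_le_trans PVp) // (bigD1 a) //= lerDl sumr_ge0 // => *; exact: PV0.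
Qed.

Definition codeword_law C (a : A) : R :=
  (cb_size C)%:R^-1 * \sum_(i < cb_size C) (C i == a)%:R.

Lemma cb_size_neq0 C : (cb_size C)%:R != 0 :> R.
Proof. by rewrite pnatr_eq0 -lt0n cb_size_gt0. Qed.

(** Trades expectations over words for averages over messages. Repeated codewords do no harm, since
    each message contributes its own indicator. *)
Lemma sum_codeword_law C (g : pred A) (F : A -> R) :
  \sum_(a | g a) codeword_law C a * F a =
  (cb_size C)%:R^-1 * \sum_(i | g (C i)) F (C i).
Proof.
under eq_bigr do rewrite -mulrA mulr_suml.
rewrite -mulr_sumr exchange_big /= [in RHS]big_mkcond; congr (_ * _).
apply: eq_bigr => i _; rewrite big_mkcond (bigD1 (C i)) //= eqxx mul1r.
rewrite big1 ?addr0 // => a; rewrite eq_sym => /negPf ->.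
by rewrite mul0r if_same.
Qed.

Lemma codeword_law_pmf C : is_pmf (codeword_law C).
Proof.
split=> [a|]; first by rewrite mulr_ge0 ?invr_ge0 ?sumr_ge0.
under eq_bigr do rewrite -[codeword_law C _]mulr1.
by rewrite sum_codeword_law sumr_const card_ord mulVf ?cb_size_neq0.
Qed.

Lemma decoder_maxl m C b i j :
  decoder m C b = Some i -> m (C i) b <= m (C j) b -> j = i.
Proof.
rewrite /decoder; case: pickP => // k /forallP dk [<-] le_kj.
apply/eqP; apply: contraLR le_kj => jk.
by rewrite -ltNge; exact: (implyP (dk j)).
Qed.

Lemma success_probE m C V : channel V ->
  1 - error_prob V C m = (cb_size C)%:R^-1 *
    \sum_(i < cb_size C) \sum_(b | decoder m C b == Some i) V (C i) b.
Proof.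
move=> chV; rewrite /error_prob -[X in X - _](mulVf (cb_size_neq0 C)) -mulrBr.
congr (_ * _); rewrite -[X in X%:R](card_ord (cb_size C)) -sumr_const -sumrB.
apply: eq_bigr => i _; rewrite -(proj2 (chV (C i))).
by rewrite (bigID (fun b => decoder m C b == Some i)) /= addrK.
Qed.

(** At output [b] with decoded message [i], [decoder_maxl] leaves [i] as the only message of metric
    value [m (C i) b]. Hence the mass of the law at that value is exactly the contribution of [i] to
    correct decoding; a declared error contributes 0. *)
Lemma success_prob_output_metric_law m C V : channel V ->
  1 - error_prob V C m = \sum_b
    oapp (fun i => output_metric_law m (codeword_law C) V b (m (C i) b)) 0
      (decoder m C b).
Proof.
move=> chV; rewrite success_probE //.
under eq_bigr do rewrite big_mkcond.
rewrite exchange_big mulr_sumr; apply: eq_bigr => b _.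
case E : (decoder m C b) => [i|] /=; last by rewrite big1 ?mulr0.
rewrite /output_metric_law (sum_codeword_law C (fun a => m a b == _)).
congr (_ * _); rewrite -big_mkcond; apply: eq_bigl => j /=.
apply/eqP/eqP => [[->] //|mji]; congr Some.
by apply/esym/(decoder_maxl E); rewrite mji.
Qed.

Lemma error_prob_output_metric_law m C V W : channel V -> channel W ->
  output_metric_law m (codeword_law C) V =
    output_metric_law m (codeword_law C) W ->
  error_prob V C m = error_prob W C m.
Proof.
move=> chV chW eqVW; apply/oppr_inj/(addrI 1).
by rewrite !success_prob_output_metric_law // eqVW.
Qed.

(* The variational bound [mutual_info_ge] is applied to the function equal to
   [M / 2] on the pairs (decoded codeword, output) and to [1 / 2] elsewhere. *)
Lemma fano m C V : channel V ->
  (1 - error_prob V C m) * ln (cb_size C)%:R - ln 2 <=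
  mutual_info (codeword_law C) V.
Proof.
move=> chV; set M : R := (cb_size C)%:R.
have Mgt0 : 0 < M by rewrite ltr0n cb_size_gt0.
(* The test function must depend on words, not messages. Nothing is lost: by [decoder_maxl] no other
   message shares the decoded word. *)
pose ok a b := omap C (decoder m C b) == Some a.
have okE i b : ok (C i) b = (decoder m C b == Some i).
  rewrite /ok; case E : (decoder m C b) => [j|] //=.
  apply/eqP/eqP => [[Cji]|[->] //]; congr Some; apply/esym.
  by apply: (decoder_maxl E); rewrite Cji.
pose f a b : R := (if ok a b then M else 1) / 2.
have [P0 P1] := codeword_law_pmf C.
apply: (@le_trans _ _
  (\sum_a \sum_b codeword_law C a * V a b * ln (f a b))); last first.
  apply: mutual_info_ge => // [a b|].
    by rewrite /f; case: ifP => _; rewrite divr_gt0.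
  rewrite exchange_big /=.
  apply: (@le_trans _ _ (\sum_b \sum_a codeword_law C a * V a b)); last first.
    rewrite exchange_big /= -P1 ler_sum // => a _.
    by rewrite -mulr_sumr (proj2 (chV a)) mulr1.
  apply: ler_sum => b _; set PY := (leRHS).
  have PY0 : 0 <= PY.
    by rewrite sumr_ge0 // => a _; rewrite mulr_ge0 // (proj1 (chV a)).
  under eq_bigr do rewrite (mulrC _ PY) -mulrA.
  rewrite -mulr_sumr ler_piMr //.
  (* For fixed [b], at most one message contributes [M / 2] and each of the [M] messages at most a
     further [1 / 2], so [f] averages to at most 1. *)
  rewrite (sum_codeword_law C predT (f^~ b)) -/M mulrC ler_pdivrMr // mul1r.
  rewrite /f -mulr_suml ler_pdivrMr // mulr2n mulrDr mulr1.
  apply: (@le_trans _ _ (\sum_i ((if ok (C i) b then M else 0) + 1))).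
    by apply: ler_sum => i _; case: ifP => _; rewrite ?add0r // lerDl.
  rewrite big_split /= sumr_const card_ord lerD2r -big_mkcond /=.
  under eq_bigl do rewrite okE.
  case: (decoder m C b) => [i|]; last by rewrite big1 // ltW.
  by rewrite (eq_bigl (pred1 i)) ?big_pred1_eq.
under eq_bigr do under eq_bigr do rewrite -mulrA.
under eq_bigr do rewrite -mulr_sumr.
rewrite (sum_codeword_law C predT (fun a => \sum_b V a b * ln (f a b))) -/M.
rewrite success_probE // -/M -mulrA mulr_suml.
rewrite -[X in _ - X](mulKf (cb_size_neq0 C)) -/M -mulrBr.
rewrite ler_pM2l ?invr_gt0 //.
rewrite -[X in X * ln 2]/((cb_size C)%:R) -[X in X%:R * ln 2]card_ord.
rewrite mulr_natl -sumr_const -sumrB; apply: ler_sum => i _.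
(* Spreading [ln 2] over the unit mass of [V (C i)] allows a termwise comparison: [ln f] is
   [ln M - ln 2] on success and [- ln 2] otherwise. *)
rewrite -[X in _ - X]mul1r -[X in X * ln 2](proj2 (chV (C i))) big_mkcond !mulr_suml -sumrB.
apply: ler_sum => b _; rewrite /f okE; case: ifP => _.
  by rewrite -mulrBr ln_div ?posrE //.
by rewrite ln_div ?posrE // ln1 mul0r !sub0r mulrN.
Qed.

End OneShotConverse.

Lemma memoryless_channel (R : realType) (X Y : finType) (W : X -> Y -> R) n :
  channel W -> channel (memoryless W n).
Proof.
move=> chW x; split=> [y|]; first by rewrite prodr_ge0 // => i _; case: (chW (x i)).
rewrite /memoryless -(bigA_distr_bigA (fun i y => W (x i) y)) big1 // => i _.
exact: (proj2 (chW (x i))).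
Qed.

Lemma limn_einf_ge (R : realType) (u : nat -> \bar R) (l : \bar R) :
  (\forall n \near \oo, l <= u n)%E -> (l <= limn_einf u)%E.
Proof.
move=> [N _ lu]; rewrite limn_einf_lim; apply: lime_ge.
  exact: is_cvg_einfs.
exists N => // n Nn; apply: le_ereal_inf_tmp => _ [k /= nk <-].
by apply: lu => /=; exact: leq_trans nk.
Qed.

Theorem theorem4 (R : realType) (X Y : finType) (W q : X -> Y -> R) :
  channel W ->
  (mismatch_capacity W q <=
   limn_einf (fun n : nat =>
     ereal_sup [set ereal_inf [set (n%:R^-1 * mutual_info P V)%R%:E | V in
                  [set V : word X n -> word Y n -> R |
                    channel V /\
                    output_metric_law (additive_metric q n) P V =
                    output_metric_law (additive_metric q n) P (memoryless W n)]]
               | P in [set P : word X n -> R | is_pmf P]]))%E.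
Proof.
move=> chW; apply: ge_ereal_sup => _ [r ach <-].
apply/lee_subgt0Pr => e e0; rewrite -EFinB.
(* The error level will be [e / d]: [d > e] puts it below 1, and [d > 3 * |r|] makes the rate loss
   [e / d * r] at most [e / 3]. The other two thirds of [e] pay for the rate slack and for
   [ln 2 / n]. *)
pose d : R := 3 * (`|r| + 1) + e.
have d0 : 0 < d by rewrite /d; have := normr_ge0 r; lra.
have eps01 : 0 < e / d < 1.
  rewrite divr_gt0 // ltr_pdivrMr // mul1r /d.
  by have := normr_ge0 r; lra.
have epsr : e / d * r <= e / 3.
  rewrite mulrAC ler_pdivrMr // -mulrA ler_pM2l // /d.
  have := ler_norm r; have := normr_ge0 r; lra.
have e3 : 0 < e / 3 by lra.
have [C Cach] := ach _ eps01 _ e3.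
have n_ln2 : \forall n \near \oo, n%:R^-1 * ln 2 <= e / 3.
  have c0 : 0 < e / 3 / ln 2 :> R by rewrite divr_gt0 // ln_gt0 // ltr1n.
  have [N _ hN] := near_infty_natSinv_lt (PosNum c0).
  (* The bound available is on the inverse of [n.+1], hence the shift of the threshold. *)
  exists N.+1 => // [[|n]] //= /ltnSE Nn.
  by rewrite -ler_pdivlMr ?ln_gt0 ?ltr1n // ltW //; exact: hN.
apply: limn_einf_ge; near=> n.
have [rateC errC] : r - e / 3 <= n%:R^-1 * ln (cb_size (C n))%:R /\
    error_prob (memoryless W n) (C n) (additive_metric q n) <= e / d.
  by near: n.
have n2 : n%:R^-1 * ln 2 <= e / 3 :> R by near: n.
apply: le_trans (ereal_sup_ubound _); last first.
  by exists (codeword_law (C n)) => //; exact: codeword_law_pmf.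
apply: le_ereal_inf_tmp => _ [V [chV eqV] <-]; rewrite lee_fin.
have chWn := @memoryless_channel R X Y W n chW.
have := fano (additive_metric q n) (C n) chV.
rewrite (error_prob_output_metric_law chV chWn eqV).
move: errC rateC; set Pe := error_prob _ _ _; set I := mutual_info _ _.
set L := ln _; set v := n%:R^-1 => errC rateC fanoI.
have v0 : 0 <= v by rewrite invr_ge0.
have L0 : 0 <= L by rewrite ln_ge0 // ler1n cb_size_gt0.
have h1 : v * ((1 - Pe) * L - ln 2) <= v * I by rewrite ler_wpM2l.
have h2 : (1 - e / d) * (v * L) <= (1 - Pe) * (v * L).
  by rewrite ler_wpM2r ?mulr_ge0 //; lra.
have h3 : (1 - e / d) * (r - e / 3) <= (1 - e / d) * (v * L).
  by rewrite ler_wpM2l //; lra.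
have h4 : 0 <= e / d * (e / 3) by rewrite mulr_ge0 //; lra.
apply: le_trans h1.
have -> : v * ((1 - Pe) * L - ln 2) = (1 - Pe) * (v * L) - v * ln 2 by ring.
(* Expanding [(1 - e / d) * (r - e / 3)] leaves [r] minus two losses of at most [e / 3], plus a
   product that [h4] shows to be nonnegative. *)
have h5 := le_trans h3 h2; clear -h4 h5 n2 epsr.
move: (e / d) ((1 - Pe) * (v * L)) (v * ln 2) n2 epsr h4 h5 => k z w.
lra.
Unshelve. all: by end_near. Qed.
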